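(* Let $A\in\mathbb{R}^{m\times n}$ be a matrix whose rows satisfy $\langle a_i,a_j\rangle=1$ if $i=j$ and $\langle a_i,a_j\rangle=0$ if $i\neq j$, and let $b\in\mathbb{R}^m$. Then for every permutation $\pi$ of $[m]$, $$T_\pi=I-A^\top A\qquad\text{and}\qquad T_\pi A^\dagger A=0.$$ Consequently, for every $x^0\in\mathbb{R}^n$, with $x^0_*:=A^\dagger b+(I-A^\dagger A)x^0$ and $\rho_{RRK}:=\max_{\pi\in S_m}\|T_\pi A^\dagger A\|_2$, the sequence $\{x^k\}_{k\geq 0}$ generated from $x^0$ by the random reshuffling Kaczmarz (RRK) method, with $\pi_k$ the permutation used in the $k$-th epoch, satisfies for every $k\geq 0$ the equalities $$\|x^{k+1}-x^0_*\|_2=\|T_{\pi_k}A^\dagger A\|_2\cdot\|x^k-x^0_*\|_2\qquad\text{and}\qquad \|x^{k}-x^0_*\|_2=\rho_{RRK}^k\,\|x^0-x^0_*\|_2,$$ and the RRK method obtains a solution of $Ax=b$ in a single step (one epoch), i.e. $Ax^1=b$.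
   Context: Notation: $[m]=\{1,\dots,m\}$; $S_m$ is the set of all permutations of $[m]$; $A^\dagger$ is the Moore-Penrose pseudoinverse of $A$; $\|\cdot\|_2$ is the Euclidean norm for vectors and the spectral norm for matrices; $a_i\in\mathbb{R}^n$ is the $i$-th row of $A$ written as a column vector, and $b_i$ is the $i$-th entry of $b$. The convention $0^0=1$ is used. RRK method: given $x^0\in\mathbb{R}^n$, for $k=0,1,2,\dots$ set $x^k_0:=x^k$, generate a random permutation $\pi_k=(\pi_{k,1},\dots,\pi_{k,m})$ of $[m]$, and for $i=1,\dots,m$ set $$x^k_i:=x^k_{i-1}-\frac{\langle a_{\pi_{k,i}},x^k_{i-1}\rangle-b_{\pi_{k,i}}}{\|a_{\pi_{k,i}}\|_2^2}\,a_{\pi_{k,i}};$$ then set $x^{k+1}:=x^k_m$. Iteration matrix: for a permutation $\pi=(\pi_1,\dots,\pi_m)$ of $[m]$, $$T_\pi:=\left(I-\frac{a_{\pi_m}a_{\pi_m}^\top}{\|a_{\pi_m}\|_2^2}\right)\cdots\left(I-\frac{a_{\pi_1}a_{\pi_1}^\top}{\|a_{\pi_1}\|_2^2}\right).$$ *)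

(* Defs.v *)
From HB Require Import structures.
From mathcomp Require Import all_boot all_order all_algebra all_fingroup.
From mathcomp Require Import boolp classical_sets reals.

Set Implicit Arguments.
Unset Strict Implicit.
Unset Printing Implicit Defensive.

Import Order.TTheory GRing.Theory Num.Theory.
Local Open Scope classical_set_scope.
Local Open Scope ring_scope.

Section Defs.
Variable R : realType.

Definition dotv n (u v : 'cV[R]_n) : R := \sum_i u i 0 * v i 0.

(* The norm that the analysis library puts on matrices is the sup norm, so the
   Euclidean norm is defined here. *)
Definition norm2 n (u : 'cV[R]_n) : R := Num.sqrt (\sum_i u i 0 ^+ 2).

(* Spectral norm, as the operator norm induced by [norm2]; the supremum is
   over a nonempty bounded set by [specnorm_has_sup]. *)
Definition specnorm m n (M : 'M[R]_(m, n)) : R :=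
  sup [set norm2 (M *m u) | u in [set u : 'cV[R]_n | norm2 u <= 1]].

(* The four Penrose equations. *)
Definition penrose m n (A : 'M[R]_(m, n)) (X : 'M[R]_(n, m)) : Prop :=
  [/\ A *m X *m A = A,
      X *m A *m X = X,
      (A *m X)^T = A *m X &
      (X *m A)^T = X *m A].

(* Moore-Penrose pseudoinverse: the unique solution of the Penrose equations
   ([mp_invP], [penrose_uniq]), so that the default value 0 is never taken.
   The library's [pinvmx] is only some generalized inverse. *)
Definition mp_inv m n (A : 'M[R]_(m, n)) : 'M[R]_(n, m) :=
  xget 0 [set X | penrose A X].

Definition rowv m n (A : 'M[R]_(m, n)) (i : 'I_m) : 'cV[R]_n := (row i A)^T.

Definition kaczmarz_step m n (A : 'M[R]_(m, n)) (b : 'cV[R]_m) (i : 'I_m)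
    (x : 'cV[R]_n) : 'cV[R]_n :=
  x - ((dotv (rowv A i) x - b i 0) / norm2 (rowv A i) ^+ 2) *: rowv A i.

(* [enum 'I_m] lists 0, ..., m - 1 in increasing order, so the rows are
   visited in the order s 0, s 1, ..., s (m - 1). *)
Definition rrk_epoch m n (A : 'M[R]_(m, n)) (b : 'cV[R]_m) (s : 'S_m)
    (x : 'cV[R]_n) : 'cV[R]_n :=
  foldl (fun y i => kaczmarz_step A b (s i) y) x (enum 'I_m).

(* One realization of the method: [pi k] is the permutation drawn in
   epoch k. *)
Fixpoint rrk m n (A : 'M[R]_(m, n)) (b : 'cV[R]_m) (pi : nat -> 'S_m)
    (x0 : 'cV[R]_n) (k : nat) : 'cV[R]_n :=
  if k is k'.+1 then rrk_epoch A b (pi k') (rrk A b pi x0 k') else x0.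

Definition row_proj m n (A : 'M[R]_(m, n)) (i : 'I_m) : 'M[R]_n :=
  1%:M - (norm2 (rowv A i) ^+ 2)^-1 *: (rowv A i *m (rowv A i)^T).

(* The factor of the last row visited stands leftmost, whence [rev_ord]. *)
Definition iter_mx m n (A : 'M[R]_(m, n)) (s : 'S_m) : 'M[R]_n :=
  \big[mulmx/1%:M]_(i < m) row_proj A (s (rev_ord i)).

(* The neutral element 0 is harmless: spectral norms are nonnegative and 'S_m
   is nonempty. *)
Definition rho_rrk m n (A : 'M[R]_(m, n)) : R :=
  \big[Num.max/0]_(s : 'S_m) specnorm (iter_mx A s *m mp_inv A *m A).

Definition xstar m n (A : 'M[R]_(m, n)) (b : 'cV[R]_m) (x0 : 'cV[R]_n) :
    'cV[R]_n :=
  mp_inv A *m b + (1%:M - mp_inv A *m A) *m x0.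

Lemma gram_unit r n (B : 'M[R]_(r, n)) : row_free B -> B *m B^T \in unitmx.
Proof.
move=> fB; rewrite -row_free_unit -kermx_eq0; apply/eqP/row_matrixP => i.
rewrite row0; set v := row i _.
have vG : v *m (B *m B^T) = 0 by rewrite -row_mul mulmx_ker row0.
have w0 : \sum_j (v *m B) 0 j ^+ 2 = 0.
  have : ((v *m B) *m (v *m B)^T) 0 0 = 0.
    by rewrite trmx_mul mulmxA -(mulmxA v) vG mul0mx mxE.
  rewrite mxE => {2}<-; apply: eq_bigr => j _.
  by rewrite [(_ ^T) _ _]mxE expr2.
apply: (row_free_inj fB); rewrite mul0mx; apply/rowP => j; rewrite [RHS]mxE.
apply/eqP; rewrite -sqrf_eq0; apply/eqP.
by apply: (psumr_eq0P _ w0) => // k _; rewrite sqr_ge0.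
Qed.

Lemma penrose_full_rank m r n (C : 'M[R]_(m, r)) (B : 'M[R]_(r, n)) :
  row_free C^T -> row_free B -> exists X, penrose (C *m B) X.
Proof.
move=> /gram_unit; rewrite trmxK => uC /gram_unit uB.
set G := B *m B^T in uB; set H := C^T *m C in uC.
have GT : G^T = G by rewrite /G trmx_mul trmxK.
have HT : H^T = H by rewrite /H trmx_mul trmxK.
pose X := B^T *m invmx G *m invmx H *m C^T.
have AX : C *m B *m X = C *m invmx H *m C^T.
  by rewrite /X !mulmxA -(mulmxA C B) -/G mulmxK.
have XA : X *m (C *m B) = B^T *m invmx G *m B.
  by rewrite /X mulmxA -[_ *m C^T *m C]mulmxA -/H mulmxKV.
exists X; split.
- by rewrite AX mulmxA -[_ *m C^T *m C]mulmxA -/H mulmxKV.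
- by rewrite XA /X !mulmxA -[_ *m B *m B^T]mulmxA -/G mulmxKV.
- by rewrite AX !trmx_mul trmxK trmx_inv HT mulmxA.
- by rewrite XA !trmx_mul trmxK trmx_inv GT mulmxA.
Qed.

Lemma penrose_ex m n (A : 'M[R]_(m, n)) : exists X, penrose A X.
Proof.
rewrite -(mulmx_base A); apply: penrose_full_rank; last exact: row_base_free.
by rewrite /row_free mxrank_tr; exact: col_base_full.
Qed.

Lemma penrose_uniq m n (A : 'M[R]_(m, n)) X Y :
  penrose A X -> penrose A Y -> X = Y.
Proof.
move=> [x1 x2 x3 x4] [y1 y2 y3 y4].
have AXY : A *m X = A *m Y.
  by rewrite -x3 -{1}y1 -(mulmxA _ A X) trmx_mul x3 y3 mulmxA x1.
have XAY : X *m A = Y *m A.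
  rewrite -x4 -{1}y1 -(mulmxA A Y A) mulmxA trmx_mul x4 y4.
  by rewrite -mulmxA (mulmxA A X A) x1.
by rewrite -x2 XAY -mulmxA AXY mulmxA y2.
Qed.

Lemma mp_invP m n (A : 'M[R]_(m, n)) : penrose A (mp_inv A).
Proof. exact: (xgetPex 0 (penrose_ex A)). Qed.

Lemma specnorm_has_sup m n (M : 'M[R]_(m, n)) :
  has_sup [set norm2 (M *m u) | u in [set u : 'cV[R]_n | norm2 u <= 1]].
Proof.
split.
  exists (norm2 (M *m 0)), 0 => //=.
  rewrite /norm2 big1 ?sqrtr0 ?ler01// => i _.
  by rewrite mxE expr0n.
exists (Num.sqrt (\sum_i (\sum_j `|M i j|) ^+ 2)) => _ [u /= u1 <-].
rewrite /norm2; apply: ler_wsqrtr; apply: ler_sum => i _.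
rewrite -real_normK ?num_real// lerXn2r ?nnegrE ?sumr_ge0//.
rewrite mxE; apply: (le_trans (ler_norm_sum _ _ _)); apply: ler_sum => j _.
rewrite normrM ler_piMr//; apply: le_trans u1.
rewrite -sqrtr_sqr; apply: ler_wsqrtr.
by rewrite (bigD1 j)//= lerDl sumr_ge0// => k _; rewrite sqr_ge0.
Qed.

End Defs.

(* Main.v *)
Require Import Defs.
From HB Require Import structures.
From mathcomp Require Import all_boot all_order all_algebra all_fingroup.
From mathcomp Require Import boolp classical_sets reals.

Set Implicit Arguments.
Unset Strict Implicit.
Unset Printing Implicit Defensive.

Import Order.TTheory GRing.Theory Num.Theory.
Local Open Scope ring_scope.

(** The rows of [A] are orthonormal, that is [A *m A^T = 1].  Expanding a product
    of the elementary projectors [1 - a_i a_i^T] over distinct rows, every mixed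
    term contains a factor [a_i^T a_j = 0], so the product is
    [1 - \sum_i a_i a_i^T], whatever the order of the factors
    ([prod_row_proj]).  Over all the rows this is [1 - A^T A].

    In the same way a Kaczmarz step along one row does not change the residual
    [<a_j, x> - b_j] of another row, so a whole epoch maps [y] to
    [y - A^T (A y - b)] for every order of the rows ([rrk_epochE]).  As [A^T] is
    here the Moore-Penrose inverse of [A] ([mp_inv_orthonormal]), this point is
    the orthogonal projection of [y] on the solution set of [A x = b].  An epoch
    leaves the component [(1 - A^T A) y] alone, hence every iterate after the
    first epoch is the projection [xstar] of the starting point
    ([rrk_succ]).  Since [(1 - A^T A) A^T A = 0], all contraction factors are
    zero, and both equalities read 0 = 0 except the second one at k = 0, which
    holds because [0 ^+ 0 = 1]. *)

Section Euclidean.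
Variable R : realType.

Lemma norm2_0 p : norm2 (0 : 'cV[R]_p) = 0.
Proof. by rewrite /norm2 big1 ?sqrtr0// => i _; rewrite mxE expr0n. Qed.

Lemma specnorm0 p q : specnorm (0 : 'M[R]_(p, q)) = 0.
Proof.
rewrite /specnorm; set S := (X in sup X); suff -> : S = [set 0]%classic.
  by rewrite sup1.
apply/seteqP; split=> [_ [u _ <-]|_ ->] /=; first by rewrite mul0mx norm2_0.
by exists 0; rewrite /= ?mulmx0 ?norm2_0.
Qed.

Lemma dotvE p (u v : 'cV[R]_p) : u^T *m v = (dotv u v)%:M.
Proof.
apply/matrixP => i j; rewrite !ord1 !mxE eqxx mulr1n.
by apply: eq_bigr => k _; rewrite mxE.
Qed.

Lemma dotv_rowv p q (B : 'M[R]_(p, q)) i x : dotv (rowv B i) x = (B *m x) i 0.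
Proof. by rewrite mxE; apply: eq_bigr => k _; rewrite !mxE. Qed.

End Euclidean.

Section OrthonormalRows.
Variables (R : realType) (m n : nat) (A : 'M[R]_(m, n)).
Hypothesis orthoA :
  forall i j : 'I_m, dotv (rowv A i) (rowv A j) = (i == j)%:R.

Lemma mulmx_tr_orthonormal : A *m A^T = 1%:M.
Proof.
apply/matrixP => i j; rewrite [RHS]mxE -orthoA mxE.
by apply: eq_bigr => k _; rewrite !mxE.
Qed.

Lemma mulmx_kernel_tr : (1%:M - A^T *m A) *m A^T = 0.
Proof.
by rewrite mulmxBl mul1mx -mulmxA mulmx_tr_orthonormal mulmx1 subrr.
Qed.

Lemma mp_inv_orthonormal : mp_inv A = A^T.
Proof.
apply: (penrose_uniq (mp_invP A)).
by split; rewrite -?mulmxA ?mulmx_tr_orthonormal ?mulmx1 ?trmx1 ?mulmxA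
  ?mulmx_tr_orthonormal ?mul1mx // trmx_mul trmxK.
Qed.

Lemma norm2_rowv i : norm2 (rowv A i) ^+ 2 = 1.
Proof.
rewrite /norm2 sqr_sqrtr ?sumr_ge0// => [|j _]; last exact: sqr_ge0.
transitivity (dotv (rowv A i) (rowv A i)); last by rewrite orthoA eqxx.
by apply: eq_bigr => j _; rewrite expr2.
Qed.

Lemma row_projE i : row_proj A i = 1%:M - rowv A i *m (rowv A i)^T.
Proof. by rewrite /row_proj norm2_rowv invr1 scale1r. Qed.

Lemma kaczmarz_stepE b i x :
  kaczmarz_step A b i x = x - (dotv (rowv A i) x - b i 0) *: rowv A i.
Proof. by rewrite /kaczmarz_step norm2_rowv divr1. Qed.

(** The vector [a_i] is orthogonal to all the rows in the sum, so the factor in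
    front only contributes its own rank-one term. *)
Lemma prod_row_proj (l : seq 'I_m) (f : 'I_m -> 'I_m) :
  injective f -> uniq l ->
  \big[mulmx/1%:M]_(i <- l) row_proj A (f i) =
    1%:M - \sum_(i <- l) rowv A (f i) *m (rowv A (f i))^T.
Proof.
move=> f_inj; elim: l => [|i l IHl] /=; first by rewrite !big_nil subr0.
case/andP=> il /IHl {}IHl; rewrite !big_cons IHl row_projE.
set u := rowv A (f i).
suff u0 : u *m u^T *m (\sum_(j <- l) rowv A (f j) *m (rowv A (f j))^T) = 0.
  by rewrite mulmxBr mulmx1 mulmxBl mul1mx u0 subr0 opprD addrA.
rewrite mulmx_sumr big_seq big1// => j jl.
rewrite mulmxA -(mulmxA u) dotvE orthoA (inj_eq f_inj).
have -> : (i == j) = false by apply: contraNF il => /eqP ->.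
by rewrite raddf0 mulmx0 mul0mx.
Qed.

(** The residual of each remaining row is the same after a step as before it,
    so all of them can be computed at the starting point. *)
Lemma foldl_kaczmarz_step b (l : seq 'I_m) (f : 'I_m -> 'I_m) x :
  injective f -> uniq l ->
  foldl (fun y i => kaczmarz_step A b (f i) y) x l =
    x - \sum_(i <- l) (dotv (rowv A (f i)) x - b (f i) 0) *: rowv A (f i).
Proof.
move=> f_inj; elim: l x => [|i l IHl] x /=; first by rewrite big_nil subr0.
case/andP=> il /IHl ->; rewrite big_cons kaczmarz_stepE opprD addrA.
congr (_ - _); rewrite !big_seq; apply: eq_bigr => j jl.
congr ((_ - _) *: _); rewrite [LHS]dotv_rowv mulmxBr -scalemxAr.
rewrite [LHS]mxE [X in _ + X]mxE [X in - X]mxE -!dotv_rowv orthoA.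
rewrite (inj_eq f_inj).
have -> : (j == i) = false by apply: contraNF il => /eqP <-.
by rewrite mulr0 subr0.
Qed.

Lemma sum_scale_rowv (c : 'cV[R]_m) :
  \sum_i c i 0 *: rowv A i = A^T *m c.
Proof.
apply/colP => j; rewrite summxE mxE.
by apply: eq_bigr => i _; rewrite !mxE mulrC.
Qed.

Lemma sum_rowv_outer : \sum_i rowv A i *m (rowv A i)^T = A^T *m A.
Proof.
apply/matrixP => j k; rewrite summxE mxE.
by apply: eq_bigr => i _; rewrite mxE big_ord1 !mxE.
Qed.

Lemma iter_mxE s : iter_mx A s = 1%:M - A^T *m A.
Proof.
have sr_inj : injective (fun i => s (rev_ord i)).
  by move=> i j /perm_inj /rev_ord_inj.
by rewrite /iter_mx prod_row_proj ?index_enum_uniq// -sum_rowv_outer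
  [in RHS](reindex_inj sr_inj).
Qed.

Lemma iter_mx_mp_inv s : iter_mx A s *m mp_inv A *m A = 0.
Proof.
by rewrite iter_mxE mp_inv_orthonormal mulmx_kernel_tr mul0mx.
Qed.

Lemma rho_rrk0 : rho_rrk A = 0.
Proof.
rewrite /rho_rrk; elim/big_ind: _ => [//|x y -> ->|s _]; first by rewrite maxxx.
by rewrite iter_mx_mp_inv specnorm0.
Qed.

Lemma rrk_epochE b s y : rrk_epoch A b s y = y - A^T *m (A *m y - b).
Proof.
rewrite /rrk_epoch foldl_kaczmarz_step ?enum_uniq//; last exact: perm_inj.
rewrite big_enum -sum_scale_rowv [in RHS](reindex_inj (@perm_inj _ s)) /=.
congr (_ - _); apply: eq_bigr => i _.
by rewrite dotv_rowv [in RHS]mxE [(- b) _ _]mxE.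
Qed.

Lemma mulmx_rrk_epoch b s y : A *m rrk_epoch A b s y = b.
Proof.
rewrite rrk_epochE mulmxBr mulmxA mulmx_tr_orthonormal mul1mx.
by rewrite opprB addrC subrK.
Qed.

(** An epoch displaces its argument by a vector of the row space, which
    [1 - A^T A] annihilates. *)
Lemma kernel_part_rrk b pi x0 k :
  (1%:M - A^T *m A) *m rrk A b pi x0 k = (1%:M - A^T *m A) *m x0.
Proof.
elim: k => [//|k <-] /=; rewrite rrk_epochE mulmxBr mulmxA.
by rewrite mulmx_kernel_tr mul0mx subr0.
Qed.

Lemma rrk_succ b pi x0 k : rrk A b pi x0 k.+1 = xstar A b x0.
Proof.
rewrite /xstar mp_inv_orthonormal -(kernel_part_rrk b pi x0 k) /= rrk_epochE.
by rewrite mulmxBr mulmxBl mul1mx mulmxA opprB addrCA.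
Qed.

End OrthonormalRows.

Theorem mainTheorem4 (R : realType) (m n : nat) (A : 'M[R]_(m, n))
    (b : 'cV[R]_m)
    (orthoA : forall i j : 'I_m, dotv (rowv A i) (rowv A j) = (i == j)%:R) :
  (forall s : 'S_m,
     iter_mx A s = 1%:M - A^T *m A /\ iter_mx A s *m mp_inv A *m A = 0) /\
  (forall (x0 : 'cV[R]_n) (pi : nat -> 'S_m),
     (forall k : nat,
        norm2 (rrk A b pi x0 k.+1 - xstar A b x0) =
          specnorm (iter_mx A (pi k) *m mp_inv A *m A) *
            norm2 (rrk A b pi x0 k - xstar A b x0) /\
        norm2 (rrk A b pi x0 k - xstar A b x0) =
          rho_rrk A ^+ k * norm2 (x0 - xstar A b x0)) /\
     A *m rrk A b pi x0 1 = b).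
Proof.
split=> [s|x0 pi]; first by split; [exact: iter_mxE | exact: iter_mx_mp_inv].
split=> [k|]; last exact: mulmx_rrk_epoch.
rewrite rrk_succ // subrr norm2_0 iter_mx_mp_inv // specnorm0 mul0r.
split=> //; rewrite rho_rrk0 //; case: k => [|k]; first by rewrite expr0 mul1r.
by rewrite rrk_succ // subrr norm2_0 expr0n mul0r.
Qed.
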